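(* Let $G$ be a Hahn group with skeleton $S(G)=[\Gamma;\{A_\gamma:\gamma\in\Gamma\}]$, where the $A_\gamma$ are nonzero abelian groups, and let $\Phi_S\colon v\text{-}\mathrm{Aut}\,G\to\mathrm{Aut}\,S(G)$ be the canonical homomorphism. Suppose that $G$ has the lifting property with respect to a given section $\Psi_S$ of $\Phi_S$, i.e. $\Psi_S\colon\mathrm{Aut}\,S(G)\to v\text{-}\mathrm{Aut}\,G$ is an injective group homomorphism with $\Phi_S\circ\Psi_S=\mathrm{id}_{\mathrm{Aut}\,S(G)}$. Put $\mathrm{Int}\,\mathrm{Aut}\,G=\ker\Phi_S$ (internal automorphisms) and $\mathrm{Ext}\,\mathrm{Aut}\,G=\Psi_S(\mathrm{Aut}\,S(G))$ ($\Psi_S$-external automorphisms). Then $v\text{-}\mathrm{Aut}\,G$ is the inner semidirect product $$v\text{-}\mathrm{Aut}\,G=\mathrm{Int}\,\mathrm{Aut}\,G\rtimes\mathrm{Ext}\,\mathrm{Aut}\,G .$$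
   Context: Let $\Gamma$ be a totally ordered set and $(A_\gamma)_{\gamma\in\Gamma}$ abelian groups. For $a\in\prod_{\gamma\in\Gamma}A_\gamma$ let $\operatorname{supp}(a)=\{\gamma: a_\gamma\ne 0\}$. The Hahn sum $\coprod_{\Gamma}A_\gamma$ (resp. Hahn product $\mathbf{H}_{\Gamma}A_\gamma$) consists of the elements with finite (resp. well ordered) support. A Hahn group with skeleton $S(G)=[\Gamma;\{A_\gamma:\gamma\in\Gamma\}]$ is a group $G$ with $\coprod_\Gamma A_\gamma\le G\le \mathbf{H}_\Gamma A_\gamma$. For $a\in A_\gamma$, $a\mathbb{1}_\gamma$ denotes the element with entry $a$ at $\gamma$ and $0$ elsewhere. The canonical valuation is $v(g)=\min\operatorname{supp}(g)$ for $g\ne0$, $v(0)=\infty$. An automorphism of $S(G)$ is a tuple $\tau=[\tau_\Gamma;\{\tau_\gamma:\gamma\in\Gamma\}]$ with $\tau_\Gamma$ an order automorphism of $\Gamma$ and, for each $\gamma$, a group isomorphism $\tau_\gamma\colon A_\gamma\to A_{\tau_\Gamma(\gamma)}$; these form a group $\mathrm{Aut}\,S(G)$ under composition. $v\text{-}\mathrm{Aut}\,G$ is the group of valuation preserving automorphisms of $G$, i.e. group automorphisms $\sigma$ for which there is an order automorphism $\sigma_\Gamma$ of $\Gamma$ with $v(\sigma(g))=\sigma_\Gamma(v(g))$ for all $g\ne0$. The homomorphism $\Phi_S$ sends $\sigma$ to $[\sigma_\Gamma;\{\sigma_\gamma:\gamma\in\Gamma\}]$, where $\sigma_\gamma(a)=(\sigma(a\mathbb{1}_\gamma))_{\sigma_\Gamma(\gamma)}$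 for $a\in A_\gamma$. *)

(* Defs.v *)
From HB Require Import structures.
From mathcomp Require Import all_boot all_order all_algebra.
From mathcomp Require Import boolp classical_sets cardinality wochoice.

Set Implicit Arguments.
Unset Strict Implicit.
Unset Printing Implicit Defensive.

Import Order.TTheory GRing.Theory.

Local Open Scope classical_set_scope.
Local Open Scope ring_scope.

(* Inner semidirect products in a possibly infinite group; finite groups have *)
(* [sdprod] but groupType has no counterpart.                                 *)
Section InnerSemidirect.
Variable W : groupType.
Implicit Types N H : set W.
Local Open Scope group_scope.

Definition subgroup H := group_closed [in H].

Definition normal_subgroup N :=
  subgroup N /\ forall x y : W, x \in N -> x ^ y \in N.

Definition inner_semidirect N H :=
  [/\ normal_subgroup N, subgroup H,
      N `&` H = [set 1] &
      [set x * y | x in N & y in H] = [set: W]].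

End InnerSemidirect.

Definition order_aut (d : Order.disp_t) (I : orderType d) (f : I -> I) :=
  {mono f : x y / (x <= y)%O} /\ bijective f.

Lemma bijective_sig (T U : Type) (f : T -> U) :
  bijective f -> {g : U -> T | cancel f g & cancel g f}.
Proof. by move=> bf; apply: cid2; case: bf => g fK gK; exists g. Qed.

Section Family.
Context {d : Order.disp_t} {I : orderType d}.
Variable A : I -> zmodType.

(* The full product of the A i, with pointwise operations. The constant gives *)
(* the zmodType instance a key; it unfolds to [forall i, A i].                *)
Definition family := forall i, A i.

HB.instance Definition _ := gen_eqMixin family.
HB.instance Definition _ := gen_choiceMixin family.

Definition family_zero : family := fun=> 0.
Definition family_opp (a : family) : family := fun i => - a i.
Definition family_add (a b : family) : family := fun i => a i + b i.

Fact family_addA : associative family_add.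
Proof. by move=> a b c; apply/functional_extensionality_dep => i; apply: addrA. Qed.
Fact family_addC : commutative family_add.
Proof. by move=> a b; apply/functional_extensionality_dep => i; apply: addrC. Qed.
Fact family_add0 : left_id family_zero family_add.
Proof. by move=> a; apply/functional_extensionality_dep => i; apply: add0r. Qed.
Fact family_addN : left_inverse family_zero family_opp family_add.
Proof. by move=> a; apply/functional_extensionality_dep => i; apply: addNr. Qed.

HB.instance Definition _ := GRing.isZmodule.Build family
  family_addA family_addC family_add0 family_addN.

Definition supp (a : family) : {pred I} := [pred i | a i != 0].

Definition hahn_sum : {pred family} := [pred a | `[< finite_set [set` supp a] >]].

Definition hahn_product : {pred family} :=
  [pred a | `[< wo_chain <=%O (supp a) >]].

(* The element with entry x at i and 0 elsewhere. *)
Definition single (i : I) (x : A i) : family := dfwith (0 : family) x.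

(* [None] plays the role of infinity. The result is meaningful on Hahn        *)
(* products, where nonempty supports have a minimum (see [hahn_valP]).        *)
Definition valuation (a : family) : option I :=
  xget None [set Some i | i in [set i | minimum_of <=%O (supp a) i]].

Record hahnGroup := HahnGroup {
  hahn_mem : zmodClosed family;
  hahn_sum_sub : {subset hahn_sum <= hahn_mem};
  hahn_sub_product : {subset hahn_mem <= hahn_product}
}.

Lemma single_in i (x : A i) : single x i = x.
Proof. by rewrite /single dfwith_in. Qed.

Lemma single_out i j (x : A i) : i != j -> single x j = 0.
Proof. by move=> ij; rewrite /single dfwith_out. Qed.

Lemma single_sum i (x : A i) : single x \in hahn_sum.
Proof.
apply/asboolP; apply: (@sub_finite_set _ _ [set i]) => [j /=|]; last exact: finite_set1.
rewrite /supp inE; apply: contraNeq => ji.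
by apply/eqP/single_out; rewrite eq_sym; apply/eqP => e; move: ji; rewrite e eqxx.
Qed.

Lemma singleB i : {morph (@single i) : x y / x - y}.
Proof.
move=> x y; apply/functional_extensionality_dep => j.
rewrite -[RHS]/(single x j - single y j).
have [<-|ij] := eqVneq i j; first by rewrite !single_in.
by rewrite !single_out ?subr0.
Qed.

Lemma valuation_eq a i : minimum_of <=%O (supp a) i -> valuation a = Some i.
Proof.
move=> [ai li]; rewrite /valuation; case: xgetP => [_ -> [j [aj lj] <-]|/(_ (Some i))].
  by congr Some; apply/le_anti; rewrite li ?lj.
by case; exists i.
Qed.

Lemma valuation_some a i : valuation a = Some i -> minimum_of <=%O (supp a) i.
Proof. by rewrite /valuation; case: xgetP => // _ -> [j mj <-] [<-]. Qed.

Lemma valuation0 : valuation 0 = None.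
Proof.
case e: (valuation 0) => [i|//]; have [] := valuation_some e.
by rewrite inE -[(0 : family) i]/(0 : A i) eqxx.
Qed.

Lemma hahn_valP a : a \in hahn_product -> a != 0 ->
  exists2 i, valuation a = Some i & minimum_of <=%O (supp a) i.
Proof.
move=> /asboolP wa a0.
have [|i [mi _]] := wa (supp a) (fun _ => id); last by exists i => //; apply: valuation_eq.
apply/not_existsP => a_eq; move/eqP: a0; apply.
apply/functional_extensionality_dep => i; apply/eqP/negPn/negP => ai.
by apply: (a_eq i).
Qed.

End Family.

Section HahnElements.
Context {d : Order.disp_t} {I : orderType d} {A : I -> zmodType}.
Variable G : hahnGroup A.

Record hahn := Hahn { hahn_val :> family A; hahnP : hahn_val \in hahn_mem G }.

HB.instance Definition _ := [isSub for hahn_val].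
HB.instance Definition _ := [Choice of hahn by <:].
HB.instance Definition _ := [SubChoice_isSubZmodule of hahn by <:].

Definition hsingle (i : I) (x : A i) : hahn :=
  Hahn (hahn_sum_sub G (single_sum x)).

Lemma hsingleB i : {morph (@hsingle i) : x y / x - y}.
Proof. by move=> x y; apply: val_inj; rewrite /= singleB. Qed.

Lemma hsingle_val i (x : A i) : x != 0 -> valuation (hsingle x) = Some i.
Proof.
move=> x0; apply: valuation_eq; split; first by rewrite inE /= single_in.
move=> j; rewrite inE /=; apply: contraNT => ij; rewrite single_out //.
by apply: contraNneq ij => ->.
Qed.

Lemma hahn_neq0 (g : hahn) : (g != 0) = (hahn_val g != 0).
Proof. by rewrite -val_eqE. Qed.

Lemma hahn_val_some (g : hahn) : g != 0 ->
  exists2 i, valuation g = Some i & minimum_of <=%O (supp g) i.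
Proof.
by rewrite hahn_neq0; apply: hahn_valP; apply: (hahn_sub_product (hahnP g)).
Qed.

Lemma hsingle_neq0 i (x : A i) : x != 0 -> hsingle x != 0.
Proof.
by move=> /hsingle_val vx; apply/eqP => e; move: vx; rewrite e valuation0.
Qed.

End HahnElements.

Section SkeletonAut.
Context {d : Order.disp_t} {I : orderType d}.
Variable A : I -> zmodType.

Record skelAut := SkelAut {
  skel_idx : I -> I;
  skel_comp : forall i, A i -> A (skel_idx i);
  skel_idxP : order_aut skel_idx;
  skel_compP : forall i, zmod_morphism (@skel_comp i) /\ bijective (@skel_comp i)
}.

HB.instance Definition _ := gen_eqMixin skelAut.
HB.instance Definition _ := gen_choiceMixin skelAut.

Fact tag_inj i (x y : A i) : Tagged A x = Tagged A y -> x = y.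
Proof. exact: eq_from_Tagged. Qed.

Fact tagB i j (x y : A i) (x' y' : A j) :
  Tagged A x = Tagged A x' -> Tagged A y = Tagged A y' ->
  Tagged A (x - y) = Tagged A (x' - y').
Proof.
by move=> ex; have /= ij := congr1 tag ex; subst j; move=> /tag_inj->; rewrite (tag_inj ex).
Qed.

(* Equality of components lives over equality of index maps, so compare the   *)
(* induced maps on the disjoint union of the A i.                             *)
Lemma skelAut_eq (s t : skelAut) :
  (forall i x, Tagged A (@skel_comp s i x) = Tagged A (@skel_comp t i x)) ->
  s = t.
Proof.
case: s t => [si sc sP sQ] [ti tc tP tQ] /= e.
have ei : si = ti by apply/funext => i; apply: (congr1 tag (e i 0)).
subst ti; have ec : sc = tc.
  apply/functional_extensionality_dep => i; apply/funext => x.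
  exact: tag_inj (e i x).
subst tc; congr SkelAut; exact: Prop_irrelevance.
Qed.

Fact skel_one_idxP : order_aut (@id I).
Proof. by split=> //; exists id. Qed.
Fact skel_one_compP i :
  zmod_morphism (@id (A i)) /\ bijective (@id (A i)).
Proof. by split=> //; exists id. Qed.
Definition skel_one := SkelAut skel_one_idxP skel_one_compP.

Section Mul.
Variables s t : skelAut.

Fact skel_mul_idxP : order_aut (skel_idx s \o skel_idx t).
Proof.
have [ms bs] := skel_idxP s; have [mt bt] := skel_idxP t.
by split; [move=> x y /=; rewrite ms mt | apply: bij_comp].
Qed.
Fact skel_mul_compP i :
  zmod_morphism (@skel_comp s (skel_idx t i) \o @skel_comp t i) /\
  bijective (@skel_comp s (skel_idx t i) \o @skel_comp t i).
Proof.
have [ms bs] := skel_compP s (skel_idx t i); have [mt bt] := skel_compP t i.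
by split; [move=> x y /=; rewrite mt ms | apply: bij_comp].
Qed.
Definition skel_mul := SkelAut skel_mul_idxP skel_mul_compP.
End Mul.

Section Inv.
Variable s : skelAut.

Definition skel_inv_idx : I -> I := s2val (bijective_sig (skel_idxP s).2).

Fact skel_idxK : cancel (skel_idx s) skel_inv_idx.
Proof. exact: (s2valP (bijective_sig (skel_idxP s).2)). Qed.
Fact skel_inv_idxK : cancel skel_inv_idx (skel_idx s).
Proof. exact: (s2valP' (bijective_sig (skel_idxP s).2)). Qed.

Fact skel_inv_sig i (x : A i) :
  {y : A (skel_inv_idx i) | Tagged A (skel_comp s y) = Tagged A x}.
Proof.
apply: cid; move: (skel_inv_idx i) (skel_inv_idxK i) x => j.
case: i /; move=> x; have [_ [g _ gK]] := skel_compP s j.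
by exists (g x); rewrite gK.
Qed.

Definition skel_inv_comp i (x : A i) := sval (skel_inv_sig x).

Fact skel_inv_compK i (x : A i) :
  Tagged A (skel_comp s (skel_inv_comp x)) = Tagged A x.
Proof. exact: (svalP (skel_inv_sig x)). Qed.

Fact skel_comp_inj i : injective (@skel_comp s i).
Proof. by have [_ /bij_inj] := skel_compP s i. Qed.

Fact skel_tag_inj i j (x : A i) (y : A j) :
  Tagged A (skel_comp s x) = Tagged A (skel_comp s y) ->
  Tagged A x = Tagged A y.
Proof.
move=> e; have /(can_inj skel_idxK) ij := congr1 tag e; subst j.
by congr existT; apply: skel_comp_inj; apply: tag_inj.
Qed.

Fact skel_inv_idxP : order_aut skel_inv_idx.
Proof.
split; last by exists (skel_idx s); [exact: skel_inv_idxK | exact: skel_idxK].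
by move=> x y; rewrite -(skel_idxP s).1 !skel_inv_idxK.
Qed.

Fact skel_inv_compP i :
  zmod_morphism (@skel_inv_comp i) /\ bijective (@skel_inv_comp i).
Proof.
split.
  move=> x y; apply: skel_comp_inj; rewrite (skel_compP s _).1.
  by apply: tag_inj; rewrite skel_inv_compK; apply: tagB; rewrite skel_inv_compK.
have ex (y : A (skel_inv_idx i)) : {x : A i | Tagged A x = Tagged A (skel_comp s y)}.
  by move: (skel_comp s y); case: _ / (esym (skel_inv_idxK i)) => x; exists x.
exists (fun y => sval (ex y)) => [x|y].
  by apply: tag_inj; rewrite (svalP (ex _)) skel_inv_compK.
apply: skel_comp_inj; apply: tag_inj.
by rewrite skel_inv_compK (svalP (ex _)).
Qed.

Definition skel_inv := SkelAut skel_inv_idxP skel_inv_compP.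
End Inv.

Fact skel_mulA : associative skel_mul.
Proof. by move=> s t u; apply: skelAut_eq. Qed.
Fact skel_mul1 : left_id skel_one skel_mul.
Proof. by move=> s; apply: skelAut_eq. Qed.
Fact skel_1mul : right_id skel_one skel_mul.
Proof. by move=> s; apply: skelAut_eq. Qed.
Fact skel_mulV : right_inverse skel_one skel_inv skel_mul.
Proof. by move=> s; apply: skelAut_eq => i x; apply: skel_inv_compK. Qed.
Fact skel_Vmul : left_inverse skel_one skel_inv skel_mul.
Proof.
by move=> s; apply: skelAut_eq => i x; apply: (skel_tag_inj (s := s)); apply: skel_inv_compK.
Qed.

HB.instance Definition _ :=
  isGroup.Build skelAut skel_mulA skel_mul1 skel_1mul skel_Vmul skel_mulV.

End SkeletonAut.

Section ValuationAut.
Context {d : Order.disp_t} {I : orderType d} {A : I -> zmodType}.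
Variable G : hahnGroup A.

Definition induces (f : hahn G -> hahn G) (p : I -> I) :=
  forall g : hahn G, g != 0 -> valuation (f g) = omap p (valuation g).

Record vAut := VAut {
  vaut_fun :> hahn G -> hahn G;
  vaut_morph : zmod_morphism vaut_fun;
  vaut_bij : bijective vaut_fun;
  vaut_val : exists p, order_aut p /\ induces vaut_fun p
}.

HB.instance Definition _ := gen_eqMixin vAut.
HB.instance Definition _ := gen_choiceMixin vAut.

Lemma vaut_eq (s t : vAut) : s =1 t -> s = t.
Proof.
case: s t => [s sm sb sv] [t tm tb tv] /= /funext e; subst t.
by congr VAut; apply: Prop_irrelevance.
Qed.

Lemma vaut0 (s : vAut) : s 0 = 0.
Proof. by rewrite -[X in s X](subrr 0) vaut_morph subrr. Qed.

Lemma vaut_neq0 (s : vAut) g : (s g != 0) = (g != 0).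
Proof. by rewrite -[in LHS](vaut0 s) (inj_eq (bij_inj (vaut_bij s))). Qed.

Fact vaut_one_val : exists p, order_aut p /\ induces id p.
Proof.
exists id; split; first exact: skel_one_idxP.
by move=> g _; case: (valuation g).
Qed.
Definition vaut_one : vAut :=
  @VAut id (fun _ _ => erefl) (Bijective (fun=> erefl) (fun=> erefl)) vaut_one_val.

Section Mul.
Variables s t : vAut.

Fact vaut_mul_morph : zmod_morphism (s \o t).
Proof. by move=> x y /=; rewrite !vaut_morph. Qed.
Fact vaut_mul_induces p q : induces s p -> induces t q -> induces (s \o t) (p \o q).
Proof.
by move=> ps qt g g0 /=; rewrite ps ?vaut_neq0 // qt //; case: (valuation g).
Qed.
Fact order_aut_comp (p q : I -> I) : order_aut p -> order_aut q -> order_aut (p \o q).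
Proof.
by move=> [mp bp] [mq bq]; split; [move=> x y /=; rewrite mp mq | apply: bij_comp].
Qed.
Fact vaut_mul_val : exists p, order_aut p /\ induces (s \o t) p.
Proof.
have [p [pa pv]] := vaut_val s; have [q [qa qv]] := vaut_val t.
by exists (p \o q); split; [exact: order_aut_comp | exact: vaut_mul_induces].
Qed.
Definition vaut_mul :=
  VAut vaut_mul_morph (bij_comp (vaut_bij s) (vaut_bij t)) vaut_mul_val.
End Mul.

Section Inv.
Variable s : vAut.

Definition vaut_inv_fun : hahn G -> hahn G := s2val (bijective_sig (vaut_bij s)).
Fact vaut_funK : cancel s vaut_inv_fun.
Proof. exact: (s2valP (bijective_sig (vaut_bij s))). Qed.
Fact vaut_inv_funK : cancel vaut_inv_fun s.
Proof. exact: (s2valP' (bijective_sig (vaut_bij s))). Qed.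
Fact vaut_inv_morph : zmod_morphism vaut_inv_fun.
Proof.
by move=> x y; apply: (can_inj vaut_funK); rewrite vaut_morph !vaut_inv_funK.
Qed.
Fact vaut_inv_val : exists p, order_aut p /\ induces vaut_inv_fun p.
Proof.
have [p [[pm [q pK qK]] pv]] := vaut_val s.
exists q; split; first by split; [move=> x y; rewrite -pm !qK | exists p].
move=> g g0; have := pv (vaut_inv_fun g).
rewrite -(vaut_neq0 s) !vaut_inv_funK => ->//.
by case: (valuation _) => //= i; rewrite pK.
Qed.
Definition vaut_inv :=
  VAut vaut_inv_morph (Bijective vaut_inv_funK vaut_funK) vaut_inv_val.
End Inv.

Fact vaut_mulA : associative vaut_mul.
Proof. by move=> s t u; apply: vaut_eq. Qed.
Fact vaut_mul1 : left_id vaut_one vaut_mul.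
Proof. by move=> s; apply: vaut_eq. Qed.
Fact vaut_1mul : right_id vaut_one vaut_mul.
Proof. by move=> s; apply: vaut_eq. Qed.
Fact vaut_mulV : right_inverse vaut_one vaut_inv vaut_mul.
Proof. by move=> s; apply: vaut_eq => g; apply: vaut_inv_funK. Qed.
Fact vaut_Vmul : left_inverse vaut_one vaut_inv vaut_mul.
Proof. by move=> s; apply: vaut_eq => g; apply: vaut_funK. Qed.

HB.instance Definition _ :=
  isGroup.Build vAut vaut_mulA vaut_mul1 vaut_1mul vaut_Vmul vaut_mulV.

(* The induced order automorphism. It is unique as soon as the A i are        *)
(* nonzero, see [vaut_idx_uniq].                                              *)
Definition vaut_idx (s : vAut) : I -> I := sval (cid (vaut_val s)).

Lemma vaut_idxP s : order_aut (vaut_idx s).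
Proof. exact: (svalP (cid (vaut_val s))).1. Qed.

Lemma vaut_idx_val (s : vAut) : induces s (vaut_idx s).
Proof. exact: (svalP (cid (vaut_val s))).2. Qed.

Lemma vaut_idx_uniq (s : vAut) p : (forall i, exists x : A i, x != 0) ->
  induces s p -> vaut_idx s = p.
Proof.
move=> A0 ps; apply/funext => i; have [x x0] := A0 i.
have := ps _ (hsingle_neq0 G x0); rewrite vaut_idx_val ?hsingle_neq0 //.
by rewrite hsingle_val // => -[].
Qed.

Definition vaut_comp (s : vAut) i (x : A i) : A (vaut_idx s i) :=
  hahn_val (s (hsingle G x)) (vaut_idx s i).

Lemma vaut_lead (s : vAut) (g : hahn G) i :
  {in supp g, forall j, (i <= j)%O} ->
  hahn_val (s g) (vaut_idx s i) = vaut_comp s (hahn_val g i).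
Proof.
move=> gi; apply/eqP; rewrite -subr_eq0.
rewrite -[_ - _]/(hahn_val (s g - s (hsingle G (hahn_val g i))) (vaut_idx s i)) -vaut_morph.
set h := g - _; have [->|h0] := eqVneq h 0; first by rewrite vaut0.
have [j vj [hj _]] := hahn_val_some h0.
have hE k : hahn_val h k = hahn_val g k - single (hahn_val g i) k by [].
have ij : (i < j)%O.
  rewrite lt_neqAle; have ij : i != j.
    by apply: contraTneq hj => <-; rewrite inE hE single_in subrr eqxx.
  rewrite ij gi //.
  by move: hj; rewrite !inE hE single_out ?subr0.
have [] := @valuation_some _ _ _ (s h) (vaut_idx s j).
  by rewrite vaut_idx_val ?vj.
move=> _ low; apply: contraTT ij => sh.
by rewrite -leNgt -(vaut_idxP s).1; apply: low.
Qed.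

Fact vaut_compP s i : zmod_morphism (@vaut_comp s i) /\ bijective (@vaut_comp s i).
Proof.
have mor : zmod_morphism (@vaut_comp s i).
  by move=> x y; rewrite /vaut_comp hsingleB vaut_morph.
split=> //.
have inj : injective (@vaut_comp s i).
  move=> x y /eqP; rewrite -subr_eq0 -mor => e.
  apply/eqP; rewrite -subr_eq0; apply: contraTT e => xy0.
  have [] := @valuation_some _ _ _ (s (hsingle G (x - y))) (vaut_idx s i).
    by rewrite vaut_idx_val ?hsingle_neq0 ?hsingle_val.
  by [].
have surj y : {x : A i | vaut_comp s x = y}.
  apply: cid; have [->|y0] := eqVneq y 0.
    by exists 0; rewrite -[X in vaut_comp s X](subrr 0) mor subrr.
  set g := vaut_inv s (hsingle G y); exists (hahn_val g i).
  rewrite -vaut_lead ?[s g]vaut_inv_funK /= ?single_in //.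
  have g0 : g != 0 by rewrite vaut_neq0 hsingle_neq0.
  have := vaut_idx_val s g0; rewrite [s g]vaut_inv_funK hsingle_val //.
  have [j vj [_ low]] := hahn_val_some g0; rewrite vj => -[].
  by move=> /(bij_inj (vaut_idxP s).2) ->.
exists (fun y => sval (surj y)) => [x|y]; last exact: (svalP (surj y)).
by apply: inj; apply: (svalP (surj _)).
Qed.

Definition Phi (s : vAut) : skelAut A := SkelAut (vaut_idxP s) (vaut_compP s).

Lemma PhiM : (forall i, exists x : A i, x != 0) ->
  {morph Phi : s t / (s * t)%g}.
Proof.
move=> A0 s t; apply: skelAut_eq => i x /=; rewrite /vaut_comp /=.
rewrite (@vaut_idx_uniq (s * t)%g (vaut_idx s \o vaut_idx t)) //; last first.
  by apply: vaut_mul_induces; apply: vaut_idx_val.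
congr existT; apply: vaut_lead => j tj.
have [x0|x0] := eqVneq x 0.
  have x00 : hsingle G x = 0.
    by rewrite x0 -[X in hsingle G X](subrr 0) hsingleB subrr.
  by move: tj; rewrite x00 vaut0 inE eqxx.
have [|_] := @valuation_some _ _ _ (t (hsingle G x)) (vaut_idx t i); last exact.
by rewrite vaut_idx_val ?hsingle_neq0 ?hsingle_val.
Qed.

Definition IntAut : set vAut := Phi @^-1` [set 1%g].

Definition ExtAut (Psi : skelAut A -> vAut) : set vAut := range Psi.

End ValuationAut.

Arguments IntAut {d I A} G _.

(* Main.v *)
Require Import Defs.
From HB Require Import structures.
From mathcomp Require Import all_boot all_order all_algebra.
From mathcomp Require Import boolp classical_sets cardinality wochoice.

(** The statement is a fact about split extensions of groups: if a group
    morphism f : W -> Q has a multiplicative section s, then W is the inner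
    semidirect product of ker f by the image of s. Indeed x = s q with f x = 1
    forces q = f (s q) = 1, so the two subgroups meet trivially; and every x
    factors as (x * (s (f x))^-1) * s (f x), whose first factor f kills. This
    is [inner_semidirect_section]. The Hahn group enters only through the
    multiplicativity of Phi, which is [PhiM] and depends on the components
    being nonzero: the order automorphism induced by a valuation preserving
    automorphism is then unique. *)

Set Implicit Arguments.
Unset Strict Implicit.
Unset Printing Implicit Defensive.

Local Open Scope ring_scope.

Section SplitExtension.
Local Open Scope classical_set_scope.
Local Open Scope group_scope.

(** A map between groups that respects products also respects quotients, as
    f (x / y) * f y = f x; unlike for monoids, f 1 = 1 comes for free. *)
Lemma morphM_morphF (W Q : groupType) (f : W -> Q) :
  {morph f : x y / x * y} -> {morph f : x y / x / y}.
Proof.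
by move=> fM x y; apply: (canRL (mulgK (f y))); rewrite -fM divgK.
Qed.

Lemma normal_subgroup_ker (W Q : groupType) (f : UMagmaMorphism.type W Q) :
  normal_subgroup (f @^-1` [set 1]).
Proof.
split; first split.
- by rewrite inE /= gmulf1.
- by move=> x y; rewrite !inE /= gmulfF => -> ->; rewrite divg1.
by move=> x y; rewrite !inE /= gmulfJ => ->; rewrite conj1g.
Qed.

Lemma subgroup_range (W Q : groupType) (f : UMagmaMorphism.type Q W) :
  subgroup (range f).
Proof.
split; first by rewrite inE; exists 1; rewrite ?gmulf1.
move=> x y; rewrite !inE => -[p _ <-] [q _ <-].
by exists (p / q); rewrite ?gmulfF.
Qed.

Lemma inner_semidirect_section (W Q : groupType)
    (f : UMagmaMorphism.type W Q) (s : UMagmaMorphism.type Q W) :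
  cancel s f -> inner_semidirect (f @^-1` [set 1]) (range s).
Proof.
move=> sK; split; [exact: normal_subgroup_ker|exact: subgroup_range| |].
- apply/seteqP; split=> [x [/= fx [q _ sq]]|x /= ->].
    by rewrite -sq -[q]sK sq fx gmulf1.
  by split; [rewrite /= gmulf1 | exists 1; rewrite ?gmulf1].
apply/seteqP; split=> // x _.
exists (x / s (f x)); first by rewrite /= gmulfF sK divgg.
by exists (s (f x)); [exists (f x) | rewrite divgK].
Qed.

End SplitExtension.

Theorem theorem3p15 (d : Order.disp_t) (Gamma : orderType d)
    (A : Gamma -> zmodType)
    (A_neq0 : forall gamma, exists x : A gamma, x != 0)
    (G : hahnGroup A)
    (Psi : {multiplicative skelAut A -> vAut G})
    (Psi_inj : injective Psi)
    (Phi_Psi : forall tau : skelAut A, Phi (Psi tau) = tau) :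
  inner_semidirect (IntAut G) (ExtAut Psi).
Proof.
pose phi : UMagmaMorphism.type (vAut G) (skelAut A) := HB.pack (@Phi _ _ _ G)
  (isGroupMorphism.Build _ _ _ (morphM_morphF (PhiM A_neq0))).
pose psi : UMagmaMorphism.type (skelAut A) (vAut G) := HB.pack (Psi : _ -> _)
  (isGroupMorphism.Build _ _ _ (morphM_morphF (@gmulfM _ _ Psi))).
exact: (@inner_semidirect_section _ _ phi psi Phi_Psi).
Qed.
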